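(* Let $f_{sq}(n)$ denote the maximum size of a point set $P\subseteq[1,n]\times[1,n]$ that does not contain (the vertex set of) a square. Then $$f_{sq}(n)=\Omega\left(\frac{n^{3/2}}{e^{O(\sqrt{\log n})}}\right),$$ that is, there exist constants $c,C>0$ such that $f_{sq}(n)\ge c\,n^{3/2}e^{-C\sqrt{\log n}}$ for all sufficiently large integers $n$.
   Context: Here $[1,n]=\{1,2,\dots,n\}$ is an integer interval, so $[1,n]\times[1,n]$ is the $n\times n$ integer grid in the Euclidean plane. Squares are non-degenerate (positive side length) and may be in any position, not necessarily with sides parallel to the axes. *)

(* Defs.v *)
From HB Require Import structures.
From mathcomp Require Import all_boot all_order all_algebra.
From mathcomp Require Import all_classical all_reals all_analysis.
Set Implicit Arguments.
Unset Strict Implicit.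
Unset Printing Implicit Defensive.
Import Order.TTheory GRing.Theory Num.Theory.
Local Open Scope ring_scope.

Definition dot (u v : int * int) : int := u.1 * v.1 + u.2 * v.2.

(* [a b c d] are the vertices, in cyclic order, of a square of positive side
   length: a parallelogram with a right angle at [a] whose two sides at [a]
   have equal positive length. All conditions are polynomial in the
   coordinates, so they are stated directly over [int]. *)
Definition is_square (a b c d : int * int) : bool :=
  [&& a != b, c - b == d - a, dot (b - a) (d - a) == 0
    & dot (b - a) (b - a) == dot (d - a) (d - a)].

(* The pair of ordinals (i, j), counted from 0, stands for (i + 1, j + 1). *)
Definition grid_point (n : nat) (p : 'I_n * 'I_n) : int * int :=
  (p.1.+1%:Z, p.2.+1%:Z).

Definition contains_square (n : nat) (P : {set 'I_n * 'I_n}) : bool :=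
  [exists a in P, exists b in P, exists c in P, exists d in P,
     is_square (grid_point a) (grid_point b) (grid_point c) (grid_point d)].

Definition f_sq (n : nat) : nat :=
  \max_(P : {set 'I_n * 'I_n} | ~~ contains_square P) #|P|.

(* Main.v *)
(* Let A be a Sidon set and S a set without three-term progressions, both in
   [0, N) with 2N <= n, and let P be the set of points (2a, N + s - a),
   in coordinates counted from 0, for a in A and s in S. The abscissas x1, x2,
   x3, x4 of a square satisfy x1 + x3 = x2 + x4, so the Sidon property forces a square in P to be
   axis-parallel; the form x + 2y, which takes the values 2N + 2s on P, maps
   three of its vertices to a nontrivial progression, which is impossible.
   Hence f_sq n >= |A| |S|. For N = 2 ^ (d ^ 2) Behrend's construction on a
   sphere in dimension d and the Erdos-Turan Sidon set of a prime p close to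
   sqrt N give |A| |S| >= N ^ (3/2) / 2 ^ O(d). A prime within a factor 2 ^ d of
   sqrt N is enough, so Chebyshev's bounds are not needed. *)
Require Import Defs.
From HB Require Import structures.
From mathcomp Require Import all_boot all_order all_algebra.
From mathcomp Require Import all_classical all_reals all_analysis.
From mathcomp Require Import zify ring lra.
Set Implicit Arguments.
Unset Strict Implicit.
Unset Printing Implicit Defensive.
Import Order.TTheory GRing.Theory Num.Theory.

(** * Primes from central binomial coefficients *)

Lemma expn2_le_central_bin N : 2 ^ N <= 'C(N.*2, N).
Proof.
elim: N => // N IH.
have h1 : 'C(N.*2, N) <= 'C(N.*2.+1, N) by case: (N) => // m; rewrite binS leq_addr.
by rewrite expnS doubleS binS binS; lia.
Qed.

(** By Legendre's formula the exponent of [p] is the sum over k of floor(2N / p^k) - 2 floor(N /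
    p^k). Each term is at most 1 and vanishes once p^k > 2N. *)
Lemma pfactor_central_bin_le p N :
  prime p -> 0 < N -> p ^ logn p 'C(N.*2, N) <= N.*2.
Proof.
move=> pp N0; set B := 'C(_, _).
have B0 : 0 < B by rewrite bin_gt0 -addnn leq_addr.
have fE : B * (N`! * N`!) = (N.*2)`!.
  by rewrite -(@bin_fact N.*2 N) -?addnn ?leq_addr// addnK addnn.
have lE : logn p B + (logn p N`!).*2 = logn p (N.*2)`!.
  by rewrite -fE lognM ?muln_gt0 ?fact_gt0// lognM ?fact_gt0// addnn.
have N20 : 0 < N.*2 by lia.
suff le_tl : logn p B <= trunc_log p N.*2.
  apply: (@leq_trans (p ^ trunc_log p N.*2)); last exact: trunc_logP (prime_gt1 pp) N20.
  by rewrite leq_exp2l// prime_gt1.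
set t := trunc_log p N.*2.
(* Zero terms extend Legendre's sum, giving both factorials the same range. *)
have logE m : m <= N.*2 -> logn p m`! = \sum_(1 <= k < N.*2.+1) m %/ p ^ k.
  move=> hm; rewrite logn_fact// [RHS](@big_cat_nat _ _ _ m.+1)//=.
  rewrite [X in _ = _ + X]big1_seq ?addn0// => k.
  rewrite mem_index_iota /= => /andP[mk _].
  by apply: divn_small; apply: (leq_trans mk); apply/ltnW/ltn_expl/prime_gt1.
move: lE; rewrite !logE; [|lia..].
rewrite -mul2n big_distrr /= => lE.
suff : \sum_(1 <= k < N.*2.+1) N.*2 %/ p ^ k <=
   \sum_(1 <= k < N.*2.+1) (2 * (N %/ p ^ k) + (k <= t)).
  rewrite big_split /= -lE addnC leq_add2l => /leq_trans; apply.
  have tle : t <= N.*2.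
    apply: ltnW; apply: leq_trans (ltn_expl t (prime_gt1 pp)) _.
    exact: trunc_logP (prime_gt1 pp) N20.
  rewrite (@big_cat_nat _ _ _ t.+1)//= [X in _ + X]big1_seq ?addn0; last first.
    by move=> k; rewrite mem_index_iota /= => /andP[tk _]; rewrite leqNgt tk.
  apply: (@leq_trans (\sum_(1 <= k < t.+1) 1)).
    by apply: leq_sum => k _; exact: leq_b1.
  by rewrite sum_nat_const_nat muln1 subn1.
apply: leq_sum => k _.
have q0 : 0 < p ^ k by rewrite expn_gt0 prime_gt0.
case: (leqP k t) => kt.
  rewrite -ltnS ltn_divLR//; have := divn_eq N (p ^ k); have := ltn_pmod N q0.
  by nia.
rewrite divn_small//; apply: leq_trans (trunc_log_ltn _ (prime_gt1 pp)) _.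
by rewrite leq_exp2l// prime_gt1.
Qed.

(* If no prime lay in (m, 2N], each of the at most m primes dividing
   C(2N, N) would contribute a factor at most 2N, contradicting
   C(2N, N) >= 2 ^ N. *)
Lemma prime_between m N :
  0 < N -> N.*2 ^ m < 2 ^ N -> exists p, [/\ prime p, m < p & p <= N.*2].
Proof.
move=> N0 lt_m; set B := 'C(N.*2, N).
have B0 : 0 < B by rewrite bin_gt0 -addnn leq_addr.
have pB p : p \in primes B -> p <= N.*2.
  rewrite mem_primes => /and3P[pp _ pB].
  have l1 : 1 <= logn p B by rewrite -pfactor_dvdn.
  apply: leq_trans (pfactor_central_bin_le pp N0).
  by rewrite -{1}(expn1 p) leq_exp2l// prime_gt1.
case: (boolP (has (fun p => m < p) (primes B))) => [/hasP[p pin mp]|].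
  by exists p; split=> //; [move: pin; rewrite mem_primes => /and3P[]|exact: pB].
rewrite -all_predC => /allP /= small; exfalso.
have szB : size (primes B) <= m.
  rewrite -(size_iota 1 m); apply: uniq_leq_size (primes_uniq _) _ => p pin.
  rewrite mem_iota; have := small p pin; move: pin; rewrite mem_primes.
  by move=> /and3P[/prime_gt0]; lia.
have BE : B <= N.*2 ^ size (primes B).
  rewrite [X in X <= _]prod_prime_decomp// prime_decompE big_map /=.
  have -> : N.*2 ^ size (primes B) = \prod_(p <- primes B) N.*2.
    by rewrite big_const_seq count_predT iter_muln_1.
  rewrite big_seq [X in _ <= X]big_seq.
  apply: leq_prod => p; rewrite mem_primes => /and3P[pp _ _].
  exact: pfactor_central_bin_le.
have := expn2_le_central_bin N; rewrite -/B => h.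
have : B <= N.*2 ^ m by apply: leq_trans BE _; rewrite leq_pexp2l//; lia.
by lia.
Qed.

(** * Additive conditions and the Erdos-Turan Sidon set *)

Definition sidon (A : seq nat) : Prop :=
  forall a b c d, a \in A -> b \in A -> c \in A -> d \in A ->
    a + c = b + d -> a = b \/ a = d.

Definition ap3_free (S : seq nat) : Prop :=
  forall a b c, a \in S -> b \in S -> c \in S -> a + c = b + b -> a = c.

(** Eliminating [c] turns the difference of the sums of squares into 2(a - b)(a - d), which the odd
    prime [p] divides. *)
Lemma eq_sum_sqr_modp p a b c d : prime p -> 2 < p ->
  a < p -> b < p -> d < p ->
  a + c = b + d -> a ^ 2 + c ^ 2 = b ^ 2 + d ^ 2 %[mod p] -> a = b \/ a = d.
Proof.
move=> pp p2 ap bp dp s /eqP q.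
have dv : (p%:Z %| (2 * ((a%:Z - b%:Z) * (a%:Z - d%:Z)))%R)%Z.
  have -> : (2 * ((a%:Z - b%:Z) * (a%:Z - d%:Z)) =
      (a ^ 2 + c ^ 2)%N%:Z - (b ^ 2 + d ^ 2)%N%:Z)%R.
    have cE : (c%:Z = b%:Z + d%:Z - a%:Z)%R by lia.
    by rewrite !PoszD -!mulnn !PoszM cE; ring.
  by rewrite -eqz_mod_dvd !modz_nat eqz_nat.
have small x y : x < p -> y < p -> p %| `|(x%:Z - y%:Z)%R| -> x = y.
  move=> xp yp dvd; apply/eqP; apply: contraTT dvd => ne.
  by rewrite gtnNdvd//; lia.
move: dv; rewrite dvdzE !abszM !Euclid_dvdM// => /or3P[/dvdn_leq|h|h]; first by lia.
- by left; apply: small.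
- by right; apply: small.
Qed.

Lemma sidon_erdos_turan p : prime p -> 2 < p ->
  exists A : seq nat, [/\ uniq A, sidon A, size A = p &
    forall a, a \in A -> a < 2 * p ^ 2].
Proof.
(* Two residues sum to less than 2p, so adding values of [g] causes no carry: the quotient by 2p
   gives a + c = b + d, the remainder the congruence of squares. *)
move=> pp p2; pose g k := 2 * p * k + k ^ 2 %% p.
have p0 : 0 < p by lia.
have gS a b c d : g a + g c = g b + g d ->
    a + c = b + d /\ a ^ 2 + c ^ 2 = b ^ 2 + d ^ 2 %[mod p].
  rewrite /g => e.
  have := ltn_pmod (a ^ 2) p0; have := ltn_pmod (b ^ 2) p0.
  have := ltn_pmod (c ^ 2) p0; have := ltn_pmod (d ^ 2) p0 => hd hc hb ha.
  have s : a + c = b + d.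
    have {}e : (a + c) * (2 * p) + (a ^ 2 %% p + c ^ 2 %% p) =
        (b + d) * (2 * p) + (b ^ 2 %% p + d ^ 2 %% p) by lia.
    have := congr1 (divn^~ (2 * p)) e; rewrite /= !divnMDl ?muln_gt0 ?p0//.
    rewrite [(a ^ 2 %% p + _) %/ _]divn_small; last by lia.
    by rewrite [(b ^ 2 %% p + _) %/ _]divn_small ?addn0//; lia.
  have s2 : 2 * p * a + 2 * p * c = 2 * p * b + 2 * p * d by rewrite -!mulnDr s.
  by split=> //; rewrite -modnDm -[RHS]modnDm; congr (_ %% _); lia.
exists [seq g k | k <- iota 0 p]; split.
- rewrite map_inj_in_uniq ?iota_uniq// => a b _ _ e.
  by have [] := gS a b a b; lia.
- move=> _ _ _ _ /mapP[a + ->] /mapP[b + ->] /mapP[c + ->] /mapP[d + ->].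
  rewrite !mem_iota !add0n => ha hb hc hd /gS[s q].
  by have [->|->] := eq_sum_sqr_modp pp p2 ha hb hd s q; [left|right].
- by rewrite size_map size_iota.
- move=> _ /mapP[k + ->]; rewrite mem_iota add0n /g => hk.
  by have := ltn_pmod (k ^ 2) p0; nia.
Qed.

(** * Digit expansions and Behrend's construction *)

Lemma digits_inj B d (f g : nat -> nat) :
  (forall i, i < d -> f i < B) -> (forall i, i < d -> g i < B) ->
  \sum_(i < d) f i * B ^ i = \sum_(i < d) g i * B ^ i ->
  forall i, i < d -> f i = g i.
Proof.
elim: d => // d IH in f g *; move=> fB gB.
have sumS (h : nat -> nat) : \sum_(i < d.+1) h i * B ^ i =
    h 0 + (\sum_(i < d) h i.+1 * B ^ i) * B.
  rewrite big_ord_recl muln1; congr (_ + _); rewrite big_distrl /=.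
  by apply: eq_bigr => i _; rewrite /bump /= add1n expnS; lia.
have f0 := fB 0 isT; have g0 := gB 0 isT.
rewrite !sumS => e.
have e0 : f 0 = g 0.
  by have := congr1 (modn^~ B) e; rewrite /= ![_ + _ * B]addnC !modnMDl !modn_small.
have eS : \sum_(i < d) f i.+1 * B ^ i = \sum_(i < d) g i.+1 * B ^ i.
  by move: e; rewrite e0 => /addnI/eqP; rewrite eqn_pmul2r; [move/eqP|lia].
(* With digits indexed by [nat], dropping the lowest one is composition with the successor. *)
case=> // i; apply: (IH (f \o S) (g \o S)) => // j jd; first exact: fB.
exact: gB.
Qed.

Lemma digits_lt B d (f : nat -> nat) : (forall i, i < d -> f i < B) ->
  \sum_(i < d) f i * B ^ i < B ^ d.
Proof.
elim: d => [|d IH] fB; first by rewrite big_ord0.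
rewrite big_ord_recr /= expnS.
apply: (@leq_trans ((f d).+1 * B ^ d)); last by rewrite leq_mul2r fB ?orbT.
by rewrite mulSn -addSn leq_add2r; apply: IH => i /ltnW; exact: fB.
Qed.

(* Parallelogram law: two points and their midpoint cannot all lie on a
   common sphere unless they coincide. *)
Lemma sphere_midpoint d (f g h : 'I_d -> nat) r :
  \sum_i f i ^ 2 = r -> \sum_i g i ^ 2 = r -> \sum_i h i ^ 2 = r ->
  (forall i, f i + g i = h i + h i) -> f =1 g.
Proof.
move=> fr gr hr fgh.
have : \sum_i `|f i - g i| ^ 2 + 4 * \sum_i h i ^ 2 =
   2 * \sum_i f i ^ 2 + 2 * \sum_i g i ^ 2.
  rewrite !big_distrr -!big_split; apply: eq_bigr => i _ /=.
  have := fgh i; nia.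
rewrite fr gr hr => e i.
have : \sum_i `|f i - g i| ^ 2 == 0 by lia.
by rewrite sum_nat_eq0 => /forallP /(_ i) /=; lia.
Qed.

Lemma pigeonhole_sum (T : finType) (F : T -> nat) K :
  (forall x, F x < K) -> exists r, #|T| <= K * #|[set x | F x == r]|.
Proof.
move=> FK.
case: (pickP (@predT T)) => [x0 _|T0]; last first.
  by exists 0; have -> : #|T| = 0 by apply: eq_card0 => x; have := T0 x.
have K0 : 0 < K by apply: leq_ltn_trans (FK x0).
pose G (r : 'I_K) := #|[set x | F x == r]|.
have [r rmax] : exists r : 'I_K, forall s, G s <= G r.
  case: (@arg_maxnP _ (Ordinal K0) xpredT G isT) => r _ h; exists r => s; exact: h.
exists (r : nat).
apply: (@leq_trans (\sum_(s < K) G r)); last first.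
  by rewrite sum_nat_const card_ord.
rewrite -sum1_card (partition_big (fun x => Ordinal (FK x)) xpredT)//=.
apply: leq_sum => s _; apply: leq_trans (rmax s).
by rewrite sum1_card /G cardsE; apply: eq_leq; apply: eq_card => x.
Qed.

(** Vectors with entries below M are read in base 2M, so adding two of them causes no carry and a
    progression of values is a midpoint relation of vectors. Squared norms take at most dM^2 + 1
    values, so some sphere holds enough vectors. *)
Lemma behrend_sphere M d : 0 < M -> exists S : seq nat,
  [/\ uniq S, ap3_free S, M ^ d <= (d * M ^ 2).+1 * size S &
      forall s, s \in S -> s < M.*2 ^ d].
Proof.
move=> M0; pose T := {ffun 'I_d -> 'I_M}.
pose nrm (f : T) := \sum_i (f i : nat) ^ 2.
pose phi (f : T) := \sum_(i < d) f i * M.*2 ^ i.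
have nrmB f : nrm f < (d * M ^ 2).+1.
  rewrite ltnS -[X in X * _](card_ord d) -sum_nat_const; apply: leq_sum => i _.
  by rewrite leq_exp2r// ltnW.
have [r hr] := pigeonhole_sum nrmB.
(* The digit lemmas expect functions on [nat]; the extension is 0 from [d] on. *)
have ext (F : 'I_d -> nat) : exists2 F' : nat -> nat, (forall i : 'I_d, F' i = F i)
    & \sum_(i < d) F i * M.*2 ^ i = \sum_(i < d) F' i * M.*2 ^ i.
  exists (fun i => if insub i is Some j then F j else 0).
    by move=> i; rewrite valK.
  by apply: eq_bigr => i _; rewrite valK.
have dig (F G : 'I_d -> nat) : (forall i, F i < M.*2) -> (forall i, G i < M.*2) ->
    \sum_(i < d) F i * M.*2 ^ i = \sum_(i < d) G i * M.*2 ^ i -> F =1 G.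
  have [F' FE ->] := ext F; have [G' GE ->] := ext G.
  move=> FB GB e i; rewrite -FE -GE; apply: digits_inj e _ (ltn_ord i) => j jd.
    by rewrite (FE (Ordinal jd)).
  by rewrite (GE (Ordinal jd)).
have phi_inj : injective phi.
  move=> f g e; apply/ffunP => i; apply: val_inj.
  by apply: dig e i => i; [have := ltn_ord (f i)|have := ltn_ord (g i)]; lia.
exists [seq phi f | f <- enum [set f | nrm f == r]]; split.
- by rewrite map_inj_uniq ?enum_uniq.
- move=> _ _ _ /mapP[f + ->] /mapP[h + ->] /mapP[g + ->].
  rewrite !mem_enum !inE => /eqP fr /eqP hr' /eqP gr.
  rewrite /phi -!big_split /= => e; congr phi.
  have {}e : \sum_(i < d) (f i + g i) * M.*2 ^ i = \sum_(i < d) (h i + h i) * M.*2 ^ i.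
    transitivity (\sum_(i < d) (f i * M.*2 ^ i + g i * M.*2 ^ i)).
      by apply: eq_bigr => i _; rewrite mulnDl.
    by rewrite e; apply: eq_bigr => i _; rewrite mulnDl.
  apply/ffunP => i; apply: val_inj.
  apply: (@sphere_midpoint d (fun i => f i) (fun i => g i) (fun i => h i) r) => // j.
  apply: dig e j => j.
    by have := ltn_ord (f j); have := ltn_ord (g j); lia.
  by have := ltn_ord (h j); lia.
- rewrite size_map -cardE; apply: leq_trans hr.
  by rewrite card_ffun !card_ord.
- move=> _ /mapP[f _ ->].
  have [F' FE] := ext (fun i => f i); rewrite /phi => ->.
  apply: digits_lt => i id; rewrite (FE (Ordinal id)).
  by have := ltn_ord (f (Ordinal id)); lia.
Qed.

(** * Squares and the grid construction *)

Section Squares.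
Local Open Scope ring_scope.

(** This exchanges the roles of the two sides at [a]; a != d follows from a != b because the sides
    have equal length. *)
Lemma is_square_sym (a b c d : int * int) : is_square a b c d -> is_square a d c b.
Proof.
move: a b c d => [x1 y1] [x2 y2] [x3 y3] [x4 y4].
case/and4P => ne /eqP [ex ey] /eqP e1 /eqP e2.
have {}ex : x3 = x2 + x4 - x1 by lia.
have {}ey : y3 = y2 + y4 - y1 by lia.
have {}e1 : (x2 - x1) * (x4 - x1) + (y2 - y1) * (y4 - y1) = 0 := e1.
have {}e2 : (x2 - x1) * (x2 - x1) + (y2 - y1) * (y2 - y1) =
  (x4 - x1) * (x4 - x1) + (y4 - y1) * (y4 - y1) := e2.
apply/and4P; split.
- apply: contra ne => /eqP [ex4 ey4]; move: e2; rewrite ex4 ey4 !subrr.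
  rewrite -!expr2 => /eqP; rewrite paddr_eq0 ?sqr_ge0// !sqrf_eq0 !subr_eq0.
  by case/andP => /eqP -> /eqP ->.
- by rewrite ex ey; apply/eqP; rewrite -[LHS]/(_, _) -[RHS]/(_, _) /=; congr pair; ring.
- by apply/eqP; rewrite -[RHS]e1 /dot /=; ring.
- by apply/eqP.
Qed.

(** If b = a + (0, t), then d = a + (t, 0) or d = a - (t, 0). In the first case [z d] is the
    midpoint of [z a] and [z b]; in the second [z a] is that of [z c] and [z d]. *)
Lemma square_vertical_side_ap3 (a b c d : int * int) (z : int * int -> int) :
  (forall p, z p = p.1 + 2 * p.2) -> is_square a b c d -> a.1 = b.1 ->
  (z a != z b /\ z a + z b = z d + z d) \/ (z c != z d /\ z c + z d = z a + z a).
Proof.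
move: a b c d => [x1 y1] [x2 y2] [x3 y3] [x4 y4] zE /[swap] /= <-; rewrite !zE /=.
case/and4P => ne /eqP [ex ey].
have y12 : y2 - y1 != 0.
  by apply: contra ne; rewrite subr_eq0 => /eqP ->.
rewrite /dot /= subrr !mul0r !add0r mulf_eq0 (negbTE y12) /= => /eqP y14.
rewrite y14 mulr0 addr0 -!expr2 eqf_sqr => /orP[]/eqP h; [left|right]; split; lia.
Qed.

End Squares.

Lemma f_sq_ge_sidon_ap3_free n N (A S : seq nat) :
  N.*2 <= n -> uniq A -> uniq S -> sidon A -> ap3_free S ->
  (forall a, a \in A -> a < N) -> (forall s, s \in S -> s < N) ->
  size A * size S <= f_sq n.
Proof.
(* [inord] needs a nonempty ordinal type; for n = 0 also N = 0, so [A] is empty. *)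
case: n => [|n] Nn uA uS sA fS AN SN.
  by case: A uA sA AN => // a A _ _ /(_ a); rewrite mem_head => /(_ isT); lia.
pose pt a s : 'I_n.+1 * 'I_n.+1 := (inord a.*2, inord (N + s - a)).
have ptE a s : a \in A -> s \in S ->
    (pt a s).1 = a.*2 :> nat /\ (pt a s).2 = N + s - a :> nat.
  by move=> /AN ha /SN hs; rewrite /= !inordK //; lia.
pose L := [seq pt a s | a <- A, s <- S].
have uL : uniq L.
  apply: allpairs_uniq => // -[a s] [a' s'].
  move=> /allpairsP[[? ?]/= [aA sS [-> ->]]] /allpairsP[[? ?]/= [aA' sS' [-> ->]]] e.
  have [e1 e2] := ptE _ _ aA sS; have [e1' e2'] := ptE _ _ aA' sS'.
  move: e1' e2'; rewrite -[pt _ _]e e1 e2; have := AN _ aA; have := AN _ aA'.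
  by move=> ? ? ? ?; congr pair; lia.
have <- : #|[set p in L]| = size A * size S.
  by rewrite cardsE (card_uniqP uL) size_allpairs.
rewrite /f_sq; apply: leq_bigmax_cond.
have inL p : p \in [set p in L] -> exists a s, [/\ a \in A, s \in S &
    grid_point p = (Posz a.*2.+1, Posz (N + s - a).+1)].
  rewrite inE => /allpairsP[[a s]/= [aA sS ->]]; exists a, s; split=> //.
  by have [e1 e2] := ptE _ _ aA sS; rewrite /grid_point e1 e2.
(* The form x + 2y cancels [a], so a progression of its values is one in [S]. *)
have zE a s : a < N ->
    (Posz a.*2.+1 + 2 * Posz (N + s - a).+1)%R = Posz (N.*2 + s.*2 + 3).
  by clear; lia.
have noV (p1 p2 p3 p4 : 'I_n.+1 * 'I_n.+1) :
    p1 \in [set p in L] -> p2 \in [set p in L] ->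
    p3 \in [set p in L] -> p4 \in [set p in L] ->
    is_square (grid_point p1) (grid_point p2) (grid_point p3) (grid_point p4) ->
    (grid_point p1).1 = (grid_point p2).1 -> False.
  move=> /inL[a1 [s1 [A1 S1 ->]]] /inL[a2 [s2 [A2 S2 ->]]].
  move=> /inL[a3 [s3 [A3 S3 ->]]] /inL[a4 [s4 [A4 S4 ->]]] sq e.
  have := square_vertical_side_ap3 (fun p => erefl (p.1 + 2 * p.2)%R) sq e.
  rewrite /= !zE ?AN// => -[] [ne h].
  - by have := fS _ _ _ S1 S4 S2; clear - ne h; lia.
  - by have := fS _ _ _ S3 S1 S4; clear - ne h; lia.
apply/negP => /existsP[p1 /andP[P1 /existsP[p2 /andP[P2]]]].
move=> /existsP[p3 /andP[P3 /existsP[p4 /andP[P4 sq]]]].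
(* The Sidon property makes one of the two sides at [p1] vertical. *)
suff [e|e] : (grid_point p1).1 = (grid_point p2).1 \/
       (grid_point p1).1 = (grid_point p4).1.
- exact: noV P1 P2 P3 P4 sq e.
- exact: noV P1 P4 P3 P2 (is_square_sym sq) e.
have := sq; case/and4P => _ /eqP + _ _.
have [a1 [s1 [A1 _ ->]]] := inL _ P1; have [a2 [s2 [A2 _ ->]]] := inL _ P2.
have [a3 [s3 [A3 _ ->]]] := inL _ P3; have [a4 [s4 [A4 _ ->]]] := inL _ P4.
case=> h _ /=; have e : a1 + a3 = a2 + a4 by clear - h; lia.
by have [->|->] := sA _ _ _ _ A1 A2 A3 A4 e; [left|right].
Qed.

(** * Choice of parameters *)

Lemma sqrn_lt_exp2 d : 4 < d -> d ^ 2 < 2 ^ d.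
Proof.
elim: d => // d IH; rewrite ltnS leq_eqVlt => /orP[/eqP <-//|h].
have : 2 * d + 1 <= d ^ 2 by rewrite -mulnn; nia.
by have := IH h; rewrite (expnS 2) -!mulnn; move: (2 ^ d) => x; lia.
Qed.

(** For N = 2^(h-1) and m = 2^(h-d), the hypothesis of [prime_between] reads h 2^(h-d) < 2^(h-1),
    that is, h < 2^(d-1). *)
Lemma prime_dyadic h d : 0 < d -> h < 2 ^ d.-1 -> d <= h ->
  exists p, [/\ prime p, 2 ^ (h - d) < p & p <= 2 ^ h].
Proof.
move=> d0 hd dh.
have dE : (2 ^ h.-1).*2 = 2 ^ h by rewrite -mul2n -expnS prednK//; lia.
rewrite -dE; apply: prime_between; first by rewrite expn_gt0.
rewrite dE -expnM ltn_exp2l//.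
have -> : h.-1 = d.-1 + (h - d) by lia.
by rewrite expnD ltn_pmul2r ?expn_gt0.
Qed.

(** Squaring keeps the bound N^(3/2), for N = 2^(d^2), within [nat]. *)
Lemma f_sq_ge_dyadic n d : 4 < d -> 2 ^ (d ^ 2).+1 <= n ->
  2 ^ (3 * d ^ 2) <= (f_sq n * 2 ^ (5 * d + 1)) ^ 2.
Proof.
move=> d4 dn; have d2 := sqrn_lt_exp2 d4.
(* The largest [h] with 2h + 1 <= d^2, so that p <= 2^h gives 2p^2 <= N. *)
pose h := ((d ^ 2).-1)./2.
have hE : (d ^ 2).-2 <= h.*2 <= (d ^ 2).-1 by rewrite /h; lia.
have d5 : 5 * d <= d ^ 2 by rewrite -mulnn leq_mul2r d4 orbT.
have dd : 2 ^ d = (2 ^ d.-1).*2 by rewrite -mul2n -expnS prednK//; lia.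
have [|||p [pp ph ph']] := @prime_dyadic h d _ _ _; [lia..|].
have p2 : 2 < p.
  apply: leq_trans ph; rewrite ltnS -{1}(expn1 2) leq_exp2l//; lia.
have [A [uA sA szA AN]] := sidon_erdos_turan pp p2.
(* Entries below 2^(d-1) give base 2^d, hence values below 2^(d^2) = N. *)
have [S [uS fS szS SN]] := @behrend_sphere (2 ^ d.-1) d (expn_gt0 _ _).
have pN : 2 * p ^ 2 <= 2 ^ (d ^ 2).
  apply: (@leq_trans (2 ^ h.*2.+1)); last by rewrite leq_exp2l//; lia.
  by rewrite (expnS 2) leq_mul2l /= -muln2 expnM leq_exp2r.
have le1 : size A * size S <= f_sq n.
  apply: (@f_sq_ge_sidon_ap3_free n (2 ^ (d ^ 2))) => //.
  - by rewrite -mul2n -expnS.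
  - by move=> a /AN/leq_trans; apply.
  - by move=> s /SN; rewrite -dd -expnM mulnn.
have le2 : 2 ^ (d * d.-1) <= 2 ^ (3 * d) * size S.
  rewrite mulnC expnM; apply: leq_trans szS _; rewrite leq_mul2r; apply/orP; right.
  have : d < 2 ^ d by exact: ltn_expl.
  rewrite (_ : 3 * d = d + d * 2) ?expnD ?expnM; last by lia.
  rewrite dd; move: (2 ^ d.-1) => x; rewrite -!mulnn; nia.
have le3 : 2 ^ (h - d + d * d.-1) <= f_sq n * 2 ^ (3 * d).
  rewrite expnD; apply: leq_trans (leq_mul (ltnW ph) le2) _.
  by rewrite mulnCA mulnC leq_mul2r -szA le1 orbT.
(* The total exponent is h + d^2 + 1, and its double is at least 3d^2 because 2h >= d^2 - 2. *)
apply: (@leq_trans ((2 ^ (h - d + d * d.-1) * 2 ^ (2 * d + 1)) ^ 2)).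
  rewrite -expnD -expnM leq_exp2l//; move: hE d5; rewrite -!mulnn; nia.
rewrite leq_exp2r// (_ : 5 * d + 1 = 3 * d + (2 * d + 1)); last by lia.
by rewrite (expnD _ (3 * d)) mulnA leq_mul2r le3 orbT.
Qed.

(** The threshold 26 = 5^2 + 1 belongs to d = 5, the least value with 4 < d. *)
Lemma exists_dyadic_square_exponent n : 2 ^ 26 <= n ->
  exists d, [/\ 4 < d, 2 ^ (d ^ 2).+1 <= n & n < 2 ^ (d.+1 ^ 2).+1].
Proof.
move=> n26.
have ex : exists d, 2 ^ (d ^ 2).+1 <= n by exists 5.
have ub d : 2 ^ (d ^ 2).+1 <= n -> d <= n.
  apply: leq_trans; apply: leq_trans (_ : d ^ 2 <= _); first by rewrite -mulnn; nia.
  by apply/ltnW/ltnW/ltn_expl.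
case: (ex_maxnP ex ub) => d dn dmax; exists d; split=> //; first exact: dmax.
by rewrite ltnNge; apply/negP => /dmax; rewrite ltnn.
Qed.

(** Since 3((d+1)^2 + 1) = 3d^2 + 2(3d + 3), rounding [n] up costs a factor 2^(3d+3) besides the
    2^(5d+1) already lost. *)
Lemma cube_le_f_sq n : 2 ^ 26 <= n ->
  exists2 d, 2 ^ (d ^ 2) <= n & n ^ 3 <= (f_sq n * 2 ^ (8 * d + 4)) ^ 2.
Proof.
move=> /exists_dyadic_square_exponent[d [d4 dn nd]]; exists d.
  by apply: leq_trans dn; rewrite leq_exp2l.
have le1 := f_sq_ge_dyadic d4 dn.
apply: (@leq_trans (2 ^ (3 * d ^ 2) * (2 ^ (3 * d + 3)) ^ 2)).
  apply: (@leq_trans ((2 ^ (d.+1 ^ 2).+1) ^ 3)); first by rewrite leq_exp2r// ltnW.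
  by rewrite -!expnM -expnD leq_exp2l// -!mulnn; lia.
rewrite (_ : 8 * d + 4 = (5 * d + 1) + (3 * d + 3)); last by lia.
by rewrite (expnD 2 (5 * d + 1)) mulnA [X in _ <= X]expnMn leq_mul2r le1 orbT.
Qed.

(** * Passage to real exponents *)

Local Open Scope classical_set_scope.
Local Open Scope ring_scope.

Lemma powR_3half_le (R : realType) (n F : nat) :
  (n ^ 3 <= F ^ 2)%N -> n%:R `^ (3 / 2) <= F%:R :> R.
Proof.
move=> le; rewrite -(@ler_pXn2r _ 2)// ?nnegrE ?powR_ge0//.
rewrite -powR_mulrn ?powR_ge0// -powRrM (_ : 3 / 2 * 2%:R = 3%:R :> R); last by field.
by rewrite powR_mulrn// -!natrX ler_nat.
Qed.

(** As ln 2 <= 1, (d ln 2)^2 <= d^2 ln 2 <= ln n. *)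
Lemma exp2_le_expR_sqrt_ln (R : realType) (n d : nat) :
  (2 ^ (d ^ 2) <= n)%N -> 2 ^+ d <= expR (Num.sqrt (ln n%:R)) :> R.
Proof.
move=> le; have n0 : (0 < n)%N by apply: leq_trans le; rewrite expn_gt0.
have ln2_ge0 : 0 <= ln 2 :> R by rewrite ln_ge0// ler1n.
have ln2_le1 : ln 2 <= 1 :> R.
  by have := @le_ln1Dx R 1; rewrite -[1 + 1]/2; apply; lra.
have -> : 2 ^+ d = expR (d%:R * ln 2) :> R by rewrite mulrC expRM_natr lnK ?posrE.
rewrite ler_expR; apply: (@le_trans _ _ (Num.sqrt ((d%:R * ln 2) ^+ 2))).
  by rewrite sqrtr_sqr ler_norm.
apply: ler_wsqrtr; apply: (@le_trans _ _ (ln ((2 ^ (d ^ 2))%:R))).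
  rewrite natrX lnXn// exprMn -natrX -[X in _ <= X]mulr_natl ler_wpM2l//.
  by rewrite expr2 ler_piMr.
by rewrite ler_ln ?posrE ?ltr0n ?expn_gt0// ler_nat.
Qed.

Theorem theorem3p22 (R : realType) :
  exists c C : R, [/\ 0 < c, 0 < C &
    \forall n \near \oo,
      c * n%:R `^ (3 / 2) * expR (- (C * Num.sqrt (ln n%:R))) <= (f_sq n)%:R].
Proof.
(* The loss 2^(8d+4) equals 2^4 (2^d)^8, and 2^d <= exp(sqrt(ln n)). *)
exists (2 ^+ 4)^-1, 8; split; [by rewrite invr_gt0 exprn_gt0|by []|].
exists (2 ^ 26)%N => // n /= /cube_le_f_sq[d dn /(@powR_3half_le R) le].
rewrite expRN mulrC ler_pdivrMl ?expR_gt0// ler_pdivrMl ?exprn_gt0//.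
apply: le_trans le _.
rewrite natrM natrX exprD [(8 * d)%N]mulnC exprM mulrA mulrC [_ * (_ ^+ 8)]mulrC.
apply: ler_wpM2l; first exact: exprn_ge0.
apply: ler_wpM2r => //; rewrite expRM_natl.
by rewrite lerXn2r ?nnegrE ?exprn_ge0 ?expR_ge0// exp2_le_expR_sqrt_ln.
Qed.
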